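(* Let $n \ge 2$. Any matrix $Q \in \mathbb{M}^{n(n-1)}$ can be decomposed, using $O(n^4)$ arithmetic operations, into a pair $(Q^R, L)$ with $Q^R \in \mathbb{M}^{n(n-1)}$ in quadratic reduced form and $L \in \mathbb{M}^n$ such that $Q[\tau] = Q^R[\tau] + L(\tau)$ for all $\tau \in \mathcal{T}_n$.
   Context: Let $N = \{1,\dots,n\}$, $N_n = N\setminus\{n\}$, and let $E = \{(i,j) : i,j \in N,\ i \neq j\}$ be the arc set of the complete directed graph on $N$. A tour is a directed Hamiltonian cycle in this graph, identified with its set of $n$ arcs; $\mathcal{T}_n$ denotes the set of all tours. $\mathbb{M}^n$ is the space of real $n\times n$ matrices indexed by $N$, and $\mathbb{M}^{n(n-1)}$ the space of real matrices whose rows and columns are indexed by $E$; the entry of $Q$ in row $(i,j)$ and column $(k,\ell)$ is $q_{ijk\ell}$. For $\tau \in \mathcal{T}_n$, $Q[\tau] := \sum_{(e,f)\in\tau\times\tau} q_{ef}$ and, for $C \in \mathbb{M}^n$, $C(\tau) := \sum_{(i,j)\in\tau} c_{ij}$. A matrix $Q \in \mathbb{M}^{n(n-1)}$ is in quadratic reduced form if (a) $Q$ is symmetric, (b) all diagonal entries of $Q$ are zero, and (c) all entries of $Q$ whose row or column is indexed by an arc in $\{(n,p),(p,n) : p \in N_n\}$ are zero. *)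

(* Defs.v *)
From mathcomp Require Import all_boot all_order all_algebra.
From mathcomp Require Import reals.

Set Implicit Arguments.
Unset Strict Implicit.
Unset Printing Implicit Defensive.

Import Order.TTheory GRing.Theory Num.Theory.
Local Open Scope ring_scope.

(* Nodes are 0, ..., n-1; the distinguished node "n" is n.-1. *)
Definition arcT (n : nat) := {e : 'I_n * 'I_n | e.1 != e.2}.

Definition arc_tail n (e : arcT n) : 'I_n := (val e).1.
Definition arc_head n (e : arcT n) : 'I_n := (val e).2.

Definition arcmx (R : realType) (n : nat) := arcT n -> arcT n -> R.

(* A tour is the arc set of a simple directed cycle through n nodes of the
   complete digraph. *)
Definition tours (n : nat) : {set {set arcT n}} :=
  [set [set e : arcT n | next p (arc_tail e) == arc_head e]
     | p : n.-tuple 'I_n & ucycleb [rel i j | i != j] p].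

Definition quad_value (R : realType) n (Q : arcmx R n) (tau : {set arcT n}) : R :=
  \sum_(ef in setX tau tau) Q ef.1 ef.2.

Definition lin_value (R : realType) n (C : 'M[R]_n) (tau : {set arcT n}) : R :=
  \sum_(e in tau) C (arc_tail e) (arc_head e).

Definition at_last_node n (e : arcT n) : bool :=
  (arc_tail e == n.-1 :> nat) || (arc_head e == n.-1 :> nat).

Definition quad_reduced (R : realType) n (Q : arcmx R n) : Prop :=
  [/\ forall e f, Q e f = Q f e,
      forall e, Q e e = 0
    & forall e f, at_last_node e || at_last_node f -> Q e f = 0].

(* Algorithms are while-programs of a unit-cost real RAM: one finite program
   serves all n.  The memory consists of natural-number variables, used for
   control and addressing, and of arrays of reals addressed by tuples of
   naturals.  There is no multiplication of naturals and no conversion from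
   reals to naturals, so naturals cannot carry out real arithmetic. *)

Inductive iexpr : Type :=
| INat of nat
| IVar of nat
| IAdd of iexpr & iexpr
| ISub of iexpr & iexpr. (* truncated *)

Inductive rexpr : Type :=
| RNat of nat
| RGet of nat & seq iexpr
| RAdd of rexpr & rexpr
| RSub of rexpr & rexpr
| RMul of rexpr & rexpr
| RDiv of rexpr & rexpr.

Inductive bexpr : Type :=
| BEqI of iexpr & iexpr
| BLtI of iexpr & iexpr
| BLtR of rexpr & rexpr
| BNot of bexpr
| BAnd of bexpr & bexpr.

Inductive cmd : Type :=
| Skip
| ISet of nat & iexpr
| RSet of nat & seq iexpr & rexpr
| Seq of cmd & cmd
| If of bexpr & cmd & cmd
| While of bexpr & cmd.

Record store (R : realType) : Type := Store {
  ivar : nat -> nat;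
  rarr : nat -> seq nat -> R
}.

Definition set_ivar (R : realType) (s : store R) (x v : nat) : store R :=
  Store (fun y => if y == x then v else ivar s y) (rarr s).

Definition set_rarr (R : realType) (s : store R) (a : nat) (ix : seq nat) (v : R)
    : store R :=
  Store (ivar s)
    (fun b jx => if (b == a) && (jx == ix) then v else rarr s b jx).

Fixpoint ieval (R : realType) (s : store R) (e : iexpr) : nat :=
  match e with
  | INat c => c
  | IVar x => ivar s x
  | IAdd e1 e2 => (ieval s e1 + ieval s e2)%N
  | ISub e1 e2 => (ieval s e1 - ieval s e2)%N
  end.

Fixpoint reval (R : realType) (s : store R) (e : rexpr) : R :=
  match e with
  | RNat c => c%:R
  | RGet a ix => rarr s a [seq ieval s e | e <- ix]
  | RAdd e1 e2 => reval s e1 + reval s e2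
  | RSub e1 e2 => reval s e1 - reval s e2
  | RMul e1 e2 => reval s e1 * reval s e2
  | RDiv e1 e2 => reval s e1 / reval s e2
  end.

Fixpoint beval (R : realType) (s : store R) (b : bexpr) : bool :=
  match b with
  | BEqI e1 e2 => ieval s e1 == ieval s e2
  | BLtI e1 e2 => (ieval s e1 < ieval s e2)%N
  | BLtR e1 e2 => reval s e1 < reval s e2
  | BNot b1 => ~~ beval s b1
  | BAnd b1 b2 => beval s b1 && beval s b2
  end.

(* Every operation on reals or naturals, comparison, connective, constant,
   memory access and assignment costs 1; so the cost of a run bounds from above
   its number of arithmetic operations. *)
Fixpoint icost (e : iexpr) : nat :=
  match e with
  | INat _ | IVar _ => 1%N
  | IAdd e1 e2 | ISub e1 e2 => (icost e1 + icost e2).+1%N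
  end.

Definition ixcost (ix : seq iexpr) : nat := sumn [seq icost e | e <- ix].

Fixpoint rcost (e : rexpr) : nat :=
  match e with
  | RNat _ => 1%N
  | RGet _ ix => (ixcost ix).+1
  | RAdd e1 e2 | RSub e1 e2 | RMul e1 e2 | RDiv e1 e2 =>
      (rcost e1 + rcost e2).+1%N
  end.

Fixpoint bcost (b : bexpr) : nat :=
  match b with
  | BEqI e1 e2 | BLtI e1 e2 => (icost e1 + icost e2).+1%N
  | BLtR e1 e2 => (rcost e1 + rcost e2).+1%N
  | BNot b1 => (bcost b1).+1
  | BAnd b1 b2 => (bcost b1 + bcost b2).+1%N
  end.

(* [exec c s s' k]: started in s, the program c halts in s' at cost k. *)
Inductive exec (R : realType) : cmd -> store R -> store R -> nat -> Prop :=
| ExecSkip s : exec Skip s s 0%N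
| ExecISet s x e :
    exec (ISet x e) s (set_ivar s x (ieval s e)) (icost e).+1
| ExecRSet s a ix e :
    exec (RSet a ix e) s
      (set_rarr s a [seq ieval s i | i <- ix] (reval s e))
      (ixcost ix + rcost e).+1%N
| ExecSeq c1 c2 s1 s2 s3 k1 k2 :
    exec c1 s1 s2 k1 -> exec c2 s2 s3 k2 ->
    exec (Seq c1 c2) s1 s3 (k1 + k2)%N
| ExecIf b c1 c2 s s' k :
    exec (if beval s b then c1 else c2) s s' k ->
    exec (If b c1 c2) s s' (bcost b + k)%N
| ExecWhileF b c s :
    ~~ beval s b -> exec (While b c) s s (bcost b)
| ExecWhileT b c s1 s2 s3 k1 k2 :
    beval s1 b -> exec c s1 s2 k1 -> exec (While b c) s2 s3 k2 ->
    exec (While b c) s1 s3 (bcost b + k1 + k2)%N.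

Lemma exec_det (R : realType) c (s s1 s2 : store R) k1 k2 :
  exec c s s1 k1 -> exec c s s2 k2 -> s1 = s2 /\ k1 = k2.
Proof.
move=> h; elim: h s2 k2 => {c s s1 k1}
  [s|s x e|s a ix e|c1 c2 t1 t2 t3 l1 l2 _ IH1 _ IH2|b c1 c2 s s' k _ IH
  |b c s bF|b c t1 t2 t3 l1 l2 bT _ IH1 _ IH2] s2 k2 h; inversion h; subst=> //;
  try by match goal with
         | H1 : is_true (beval ?s ?b), H2 : is_true (~~ beval ?s ?b) |- _ =>
             rewrite H1 in H2
         end.
- by do 2![match goal with
           | IH : forall s k, exec ?c ?t s k -> _, H : exec ?c ?t _ _ |- _ =>
               have [? ?] := IH _ _ H; clear IH; subst
           end].
- by match goal with H : exec _ _ _ _, H' : exec _ _ s2 _ |- _ =>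
       have [-> ->] := IH _ _ H' end.
- by do 2![match goal with
           | IH : forall s k, exec ?c ?t s k -> _, H : exec ?c ?t _ _ |- _ =>
               have [? ?] := IH _ _ H; clear IH; subst
           end].
Qed.

Definition holds_arcmx (R : realType) n (s : store R) (a : nat) (Q : arcmx R n) :=
  forall e f : arcT n,
    rarr s a [:: val (arc_tail e); val (arc_head e); val (arc_tail f); val (arc_head f)] = Q e f.

Definition holds_mx (R : realType) n (s : store R) (a : nat) (C : 'M[R]_n) :=
  forall i j : 'I_n, rarr s a [:: val i; val j] = C i j.

(* Input: n in variable 0 and Q in array 0, all other memory cells being
   arbitrary.  Output: QR in array 1 and L in array 2. *)
Definition computes_at_cost (R : realType) n (c : cmd) (Q QR : arcmx R n)
    (L : 'M[R]_n) (bound : nat) : Prop :=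
  forall s : store R, ivar s 0%N = n -> holds_arcmx s 0%N Q ->
  exists (s' : store R) (k : nat),
    [/\ exec c s s' k, (k <= bound)%N, holds_arcmx s' 1%N QR & holds_mx s' 2%N L].

(* Main.v *)
(* For a fixed arc e the row Q(e, .) is a linear cost on tours.  Subtracting from
   each arc (k, l) the costs of (k, n) and (n, l) kills the arcs at n, and changes
   the cost of every tour by the same constant, as a tour leaves and enters every
   node exactly once; this constant becomes a linear cost of e.  Reducing rows and
   then columns gives a matrix vanishing at the arcs at n; it is symmetrised, and
   its diagonal is moved to the linear part.  Each entry of the result depends on
   boundedly many entries of the previous matrix, and each linear cost is a sum of
   O(n) terms, so that O(n^4) operations suffice. *)
Require Import Defs.
From mathcomp Require Import all_boot all_order all_algebra.
From mathcomp Require Import reals ring zify.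

Set Implicit Arguments.
Unset Strict Implicit.
Unset Printing Implicit Defensive.

Import Order.TTheory GRing.Theory Num.Theory.
Local Open Scope ring_scope.

(** * Tours as permutations of the nodes *)

(** The permutation is the successor map [next p] of the cycle: each node is the tail of exactly one
    arc of the tour, so sums over arcs become sums over tails. *)
Lemma tour_sum (n : nat) (tau : {set arcT n}) : tau \in tours n ->
  exists s : 'I_n -> 'I_n, [/\ injective s, forall i, s i != i
    & forall (V : nmodType) (F : 'I_n -> 'I_n -> V),
        \sum_(e in tau) F (arc_tail e) (arc_head e) = \sum_i F i (s i)].
Proof.
case/imsetP=> p; rewrite inE => /andP[cyc_p uniq_p] ->.
have p_all i : i \in (p : seq _).
  have /subset_cardP eq_p : #|p| = #|'I_n|.
    by rewrite (card_uniqP uniq_p) size_tuple card_ord.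
  by rewrite (eq_p _ i) //; apply/subsetP.
have nx_neq i : next p i != i by rewrite eq_sym; exact: (next_cycle cyc_p).
exists (next p); split=> // [|V F].
  exact: can_inj (prev_next uniq_p).
(* [arc] inverts [arc_tail] on the tour; the sum is reindexed along it. *)
pose arc i : arcT n := Sub (i, next p i) (etrans (congr1 negb (eq_sym _ _)) (nx_neq i)).
rewrite (reindex_onto arc (@arc_tail n)) => [|e].
  apply: eq_bigl => i.
  by rewrite inE /arc_tail /arc_head SubK /= !eqxx.
rewrite inE => /eqP hd_e; apply: val_inj => /=.
by rewrite hd_e /arc_tail /arc_head -surjective_pairing.
Qed.

(** * Reduction of matrices and correctness of the decomposition *)

Section Reduction.
Variable R : realType.

(** At most one term of the double sum survives, so this is a lookup by plain naturals, with default
    value 0 when a pair of indices is not an arc. *)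
Definition ext_arcmx n (Q : arcmx R n) (i j k l : nat) : R :=
  \sum_(e | (arc_tail e == i :> nat) && (arc_head e == j :> nat))
    \sum_(f | (arc_tail f == k :> nat) && (arc_head f == l :> nat)) Q e f.

Lemma arc_eqP n (e f : arcT n) :
  ((arc_tail e == arc_tail f :> nat) && (arc_head e == arc_head f :> nat)) = (e == f).
Proof. by []. Qed.

Lemma ext_arcmxE n (Q : arcmx R n) (e f : arcT n) :
  ext_arcmx Q (arc_tail e) (arc_head e) (arc_tail f) (arc_head f) = Q e f.
Proof.
rewrite /ext_arcmx (big_pred1 e) => [|g]; last exact: arc_eqP.
by rewrite (big_pred1 f) // => g; exact: arc_eqP.
Qed.

Lemma arc_neq n (e : arcT n) (i : nat) :
  (arc_tail e == i :> nat) && (arc_head e == i :> nat) = false.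
Proof.
apply/negP => /andP[/eqP ti /eqP hi]; have /eqP := valP e; apply.
by apply: val_inj; rewrite /= -/(arc_tail e) -/(arc_head e) ti hi.
Qed.

Lemma ext_arcmx_diag n (Q : arcmx R n) (i j k l : nat) :
  (i == j) || (k == l) -> ext_arcmx Q i j k l = 0.
Proof.
rewrite /ext_arcmx => /orP[] /eqP ->; first by rewrite big_pred0 // => e; exact: arc_neq.
by rewrite big1 // => e _; rewrite big_pred0 // => f; exact: arc_neq.
Qed.

(* [reduce_tour] holds only when [c] vanishes on the diagonal entry (m, m), which
   is why matrices indexed by arcs are extended by zero to all pairs of nodes. *)
Definition reduce (m : nat) (c : nat -> nat -> R) (k l : nat) : R :=
  if (k == m) || (l == m) then 0 else c k l - c k m - c m l.

Definition reduce_const (n m : nat) (c : nat -> nat -> R) : R :=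
  \sum_(t < n) (c t m + c m t).

(** As [s] is a permutation, the subtracted terms [c i m] and [c m (s i)] sum to [reduce_const]. At
    the two arcs meeting [m] the balance is exact because [c m m = 0]. *)
Lemma reduce_tour n (m : 'I_n) (c : nat -> nat -> R) (s : 'I_n -> 'I_n) :
    injective s -> s m != m -> c m m = 0 ->
  \sum_(i < n) c i (s i) = \sum_(i < n) reduce m c i (s i) + reduce_const n m c.
Proof.
move=> inj_s sm cmm; rewrite /reduce_const big_split /=.
rewrite [X in _ + (_ + X)](reindex s) /=; last exact: onW_bij (injF_bij inj_s).
rewrite -!big_split /=; apply: eq_bigr => i _; rewrite /reduce.
case: ifP => [/orP[] /eqP /[dup] /val_inj|_].
- by move=> -> _; rewrite cmm !add0r.
- by move=> _ ->; rewrite cmm add0r addr0.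
- by ring.
Qed.

Variable n : nat.
Variable Q : arcmx R n.
Let m := n.-1.
Let q := ext_arcmx Q.

Definition right_reduced i j : nat -> nat -> R := reduce m (q i j).

Definition reduced i j k l : R :=
  reduce m (fun i' j' => right_reduced i' j' k l) i j.

Definition sym_reduced i j k l : R :=
  if (i == k) && (j == l) then 0 else (reduced i j k l + reduced k l i j) / 2%:R.

(** The three terms are the diagonal entry moved out of the quadratic part, the constant from
    reducing row [(i, j)], and the constant from reducing column [(i, j)] afterwards. *)
Definition linear_part i j : R :=
  reduced i j i j + reduce_const n m (q i j)
  + reduce_const n m (fun i' j' => right_reduced i' j' i j).

(** The outer reduction clears the rows at [m]. The columns cleared by the inner one stay zero,
    since only zeros are combined there. *)
Lemma reduced_last i j k l :
  [|| i == m, j == m, k == m | l == m] -> reduced i j k l = 0.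
Proof.
rewrite orbA /reduced /right_reduced /reduce; case: ifP => //= _ ->.
by rewrite !subr0.
Qed.

Definition quad_part : arcmx R n := fun e f =>
  sym_reduced (arc_tail e) (arc_head e) (arc_tail f) (arc_head f).

Lemma quad_part_reduced : quad_reduced quad_part.
Proof.
rewrite /quad_part /sym_reduced; split=> [e f|e|e f].
- rewrite (eq_sym (arc_tail e : nat)) (eq_sym (arc_head e : nat)).
  by rewrite [X in X / _]addrC.
- by rewrite !eqxx.
rewrite /at_last_node -orbA => ef; case: ifP => // _.
rewrite !reduced_last ?addr0 ?mul0r //.
by rewrite orbA orbC -orbA.
Qed.

Lemma quad_value_sum (P : arcmx R n) (tau : {set arcT n}) :
  quad_value P tau = \sum_(e in tau) \sum_(f in tau) P e f.
Proof.
rewrite /quad_value pair_big /=; apply: eq_bigl => -[e f].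
by rewrite in_setX.
Qed.

Lemma decompose_tour (tau : {set arcT n}) : (2 <= n)%N -> tau \in tours n ->
  quad_value Q tau = quad_value quad_part tau
    + lin_value (\matrix_(i, j) linear_part i j) tau.
Proof.
move=> n2 /tour_sum[s [inj_s s_neq sumE]].
have lt_m : (m < n)%N by rewrite /m prednK // ltnW.
rewrite !quad_value_sum /lin_value.
rewrite (sumE _ (fun i j => (\matrix_(i, j) linear_part i j) i j)).
under eq_bigr => e _.
  under eq_bigr => f _ do rewrite -ext_arcmxE.
  rewrite (sumE _ (fun k l => q (arc_tail e) (arc_head e) k l)).
  over.
rewrite (sumE _ (fun i j => \sum_(k < n) q i j k (s k))) /=.
under [X in _ = X + _]eq_bigr => e _.
  rewrite (sumE _ (fun k l => sym_reduced (arc_tail e) (arc_head e) k l)).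
  over.
rewrite (sumE _ (fun i j => \sum_(k < n) sym_reduced i j k (s k))) /=.
(* Each row [(i, s i)] is reduced; its extension vanishes at the non-arc [(m, m)]. *)
under eq_bigr => i _.
  rewrite (@reduce_tour n (Ordinal lt_m)) ?s_neq //; last first.
    by rewrite /q ext_arcmx_diag ?eqxx ?orbT.
  over.
(* With the sum over rows innermost, each column [(k, s k)] is a linear cost to which the same
   reduction applies. *)
rewrite big_split /= exchange_big /=.
under eq_bigr => k _.
  rewrite (@reduce_tour n (Ordinal lt_m) (fun i j => right_reduced i j k (s k))) ?s_neq //.
    over.
  rewrite /right_reduced /reduce /q !ext_arcmx_diag ?eqxx //= !subr0.
  by case: ifP.
under [X in _ = _ + X]eq_bigr => i _ do rewrite mxE.
rewrite /linear_part !big_split /= -/m.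
suff -> : \sum_(k < n) \sum_(i < n) reduced i (s i) k (s k)
   = \sum_(i < n) \sum_(k < n) sym_reduced i (s i) k (s k)
     + \sum_(i < n) reduced i (s i) i (s i) by rewrite -!addrA; congr (_ + (_ + _)); rewrite addrC.
(* Swapping the summation indices shows that averaging with the transpose preserves the double
   sum. *)
have -> : \sum_(k < n) \sum_(i < n) reduced i (s i) k (s k) =
  \sum_(i < n) \sum_(k < n) (reduced i (s i) k (s k) + reduced k (s k) i (s i)) / 2%:R.
  under [RHS]eq_bigr do rewrite -mulr_suml big_split /=.
  rewrite -mulr_suml big_split /= exchange_big /=.
  by field.
rewrite -big_split /=; apply: eq_bigr => i _.
(* The terms [k = i] are isolated: there [sym_reduced] is zero, and the averaged entry is the
   diagonal entry itself. *)
rewrite (bigD1 i) //= [in RHS](bigD1 i) //=.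
have -> : sym_reduced i (s i) i (s i) = 0 by rewrite /sym_reduced !eqxx.
rewrite add0r addrC.
congr (_ + _); last by field.
apply: eq_bigr => k ki; rewrite /sym_reduced.
by rewrite (eq_sym (i : nat)) val_eqE (negPf ki).
Qed.

End Reduction.

(** * Counting loops and cost-bounded total correctness *)

Definition for_loop (x : nat) (c : cmd) : cmd :=
  Seq (ISet x (INat 0))
      (While (BLtI (IVar x) (IVar 0))
         (Seq c (ISet x (IAdd (IVar x) (INat 1))))).

Section Programs.
Variable R : realType.
Implicit Types (s t : store R) (r : nat -> seq nat -> R).

(* Only variables below [x] are compared: the body of the loop on variable [x]
   overwrites only the variables above [x]. *)
Definition agree x s t : Prop := forall y, (y < x)%N -> ivar t y = ivar s y.

Lemma agree_trans x s t u : agree x s t -> agree x t u -> agree x s u.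
Proof. by move=> st tu y yx; rewrite tu ?st. Qed.

Lemma agree_le x y s t : (x <= y)%N -> agree y s t -> agree x s t.
Proof. by move=> xy st z zx; apply: st; exact: leq_trans xy. Qed.

Lemma agree_set x s t v : agree x s t -> agree x s (set_ivar t x v).
Proof. by move=> st y yx /=; rewrite ltn_eqF // st. Qed.

(** A Hoare-style total-correctness judgement from a fixed initial store, with a cost bound. *)
Definition runs c s (P : store R -> Prop) (bound : nat) : Prop :=
  exists s' k, [/\ exec c s s' k, (k <= bound)%N & P s'].

Lemma runs_leq c s P b b' : runs c s P b -> (b <= b')%N -> runs c s P b'.
Proof.
by move=> [s' [k [ex kb Ps']]] bb; exists s', k; split=> //; exact: leq_trans bb.
Qed.

Lemma runs_sub c s (P P' : store R -> Prop) b :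
  runs c s P b -> (forall t, P t -> P' t) -> runs c s P' b.
Proof.
by move=> [s' [k [ex kb Ps']]] PP'; exists s', k; split=> //; exact: PP'.
Qed.

Lemma runs_seq c1 c2 s (P1 P2 : store R -> Prop) b1 b2 :
    runs c1 s P1 b1 -> (forall t, P1 t -> runs c2 t P2 b2) ->
  runs (Seq c1 c2) s P2 (b1 + b2).
Proof.
move=> [s1 [k1 [ex1 kb1 Ps1]]] /(_ s1 Ps1)[s2 [k2 [ex2 kb2 Ps2]]].
by exists s2, (k1 + k2)%N; split=> //; [exact: ExecSeq ex1 ex2 | exact: leq_add].
Qed.

Lemma runs_iset s x e (P : store R -> Prop) :
  P (set_ivar s x (ieval s e)) -> runs (ISet x e) s P (icost e).+1.
Proof. by move=> Ps; exists (set_ivar s x (ieval s e)), (icost e).+1; split=> //; exact: ExecISet. Qed.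

Lemma runs_rset s a ix e (P : store R -> Prop) :
  P (set_rarr s a [seq ieval s i | i <- ix] (reval s e)) ->
  runs (RSet a ix e) s P (ixcost ix + rcost e).+1.
Proof. by move=> Ps; do 2!eexists; split; [exact: ExecRSet| |exact: Ps]. Qed.

(** An iteration costs 3 for the guard, [b] for the body and 4 for the increment. Initialisation (2)
    and the final guard (3) are absorbed into [5 * n], as [n] is positive; hence the 12. *)
Lemma runs_for n x c s (I : nat -> (nat -> seq nat -> R) -> Prop)
    (P : (nat -> seq nat -> R) -> Prop) b :
    (0 < x)%N -> (0 < n)%N -> ivar s 0 = n ->
    I 0%N (rarr s) -> (forall r, I n r -> P r) ->
    (forall i t, (i < n)%N -> agree x s t -> ivar t x = i -> I i (rarr t) ->
       runs c t (fun u => agree x.+1 t u /\ I i.+1 (rarr u)) b) ->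
  runs (for_loop x c) s (fun t => agree x s t /\ P (rarr t)) (n * (b + 12)).
Proof.
move=> x0 n0 sn I0 IP body.
(* Induction on the number [d] of remaining iterations. *)
suff loop d t : (d <= n)%N -> agree x s t ->
    ivar t x = (n - d)%N -> I (n - d)%N (rarr t) ->
    runs (While (BLtI (IVar x) (IVar 0)) (Seq c (ISet x (IAdd (IVar x) (INat 1)))))
      t (fun u => agree x s u /\ P (rarr u)) (d * (b + 7) + 3).
  apply: (@runs_leq _ _ _ (2 + (n * (b + 7) + 3))).
    apply: (@runs_seq _ _ _ (fun t => t = set_ivar s x 0)); first exact: runs_iset.
    move=> t ->; apply: loop; rewrite ?subnn //= ?eqxx //.
    exact: agree_set.
  by rewrite (addnA b 7 5) [in leqRHS]mulnDr; lia.
elim: d t => [|d IHd] t dn st tx It.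
  exists t, 3%N; split=> //; last by split=> //; apply: IP; rewrite subn0 in It.
  by apply: ExecWhileF; rewrite /= tx st // sn subn0 ltnn.
have lt_d : (n - d.+1 < n)%N by rewrite ltn_subrL n0.
have eq_d : (n - d.+1).+1 = (n - d)%N by rewrite subnSK.
have [t1 [k1 [ex1 kb1 [tt1 It1]]]] := body _ t lt_d st tx It.
pose t2 := set_ivar t1 x (ivar t1 x + 1).
have [||||u [k3 [ex3 kb3 Pu]]] := IHd t2.
- exact: ltnW.
- by apply: agree_set; apply: agree_trans st _; exact: agree_le tt1.
- by rewrite /= eqxx tt1 // tx addn1.
- by rewrite -eq_d.
exists u, (3 + (k1 + 4) + k3)%N; split=> //; last first.
  by rewrite mulSn; lia.
apply: ExecWhileT ex3; first by rewrite /= tx st ?sn.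
by apply: ExecSeq ex1 _; exact: ExecISet.
Qed.

(** * Filling an array with four indices *)

Definition cell4 : seq iexpr := [:: IVar 1; IVar 2; IVar 3; IVar 4].

Definition fill (a : nat) (b : bexpr) (e : rexpr) : cmd :=
  for_loop 1 (for_loop 2 (for_loop 3 (for_loop 4
    (If b (RSet a cell4 (RNat 0)) (RSet a cell4 e))))).

(** Here 54 is 6 + 48: 6 covers the address, the assignment and a possible constant 0, and 48 the
    overhead 12 of each of four loops. *)
Definition fill_cost b e n : nat := n ^ 4 * (bcost b + rcost e + 54).

Definition filled r a n (out : nat -> nat -> nat -> nat -> R) : Prop :=
  forall i j k l, (i < n)%N -> (j < n)%N -> (k < n)%N -> (l < n)%N ->
  r a [:: i; j; k; l] = out i j k l.

Lemma loop4_cost n b : (0 < n)%N ->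
  (n * (n * (n * (n * (b + 12) + 12) + 12) + 12) <= n ^ 4 * (b + 48))%N.
Proof.
move=> n0; have := leq_pexp2l n0 (isT : 1 <= 4)%N.
have := leq_pexp2l n0 (isT : 2 <= 4)%N.
have := leq_pexp2l n0 (isT : 3 <= 4)%N.
have -> : (n * (n * (n * (n * (b + 12) + 12) + 12) + 12)
  = n ^ 4 * b + 12 * (n ^ 4 + n ^ 3 + n ^ 2 + n ^ 1))%N by rewrite !expnS expn0; lia.
by lia.
Qed.

(** The premise on [b] and [e] may rely on the initial contents of every array except [a], which is
    being overwritten. *)
Lemma runs_fill a b e s n (out : nat -> nat -> nat -> nat -> R) :
    (0 < n)%N -> ivar s 0 = n ->
    (forall t, ivar t 0 = n -> (forall x, x != a -> rarr t x = rarr s x) ->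
       (ivar t 1 < n)%N -> (ivar t 2 < n)%N -> (ivar t 3 < n)%N -> (ivar t 4 < n)%N ->
       (if beval t b then 0 else reval t e)
         = out (ivar t 1) (ivar t 2) (ivar t 3) (ivar t 4)) ->
  runs (fill a b e) s
    (fun t => [/\ ivar t 0 = n, forall x, x != a -> rarr t x = rarr s x
       & filled (rarr t) a n out])
    (fill_cost b e n).
Proof.
move=> n0 sn step.
pose inv (W : nat -> nat -> nat -> nat -> Prop) r :=
  (forall x, x != a -> r x = rarr s x) /\
  forall i j k l, W i j k l -> (i < n)%N -> (j < n)%N -> (k < n)%N -> (l < n)%N ->
    r a [:: i; j; k; l] = out i j k l.
have inv_sub (W W' : nat -> nat -> nat -> nat -> Prop) r :
    (forall i j k l, (i < n)%N -> (j < n)%N -> (k < n)%N -> (l < n)%N ->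
       W' i j k l -> W i j k l) -> inv W r -> inv W' r.
  by move=> WW' [fr wr]; split=> // i j k l *; apply: wr => //; exact: WW'.
have agree0 x t : (0 < x)%N -> agree x s t -> ivar t 0 = n by move=> x0 ->.
(* [W] is the set of cells written so far, in lexicographic order. *)
pose W1 i0 i (j k l : nat) := (i < i0)%N.
pose W2 i0 j0 i j k l := W1 i0 i j k l \/ i = i0 /\ (j < j0)%N.
pose W3 i0 j0 k0 i j k l := W2 i0 j0 i j k l \/ (i = i0 /\ j = j0) /\ (k < k0)%N.
pose W4 i0 j0 k0 l0 i j k l :=
  W3 i0 j0 k0 i j k l \/ (i = i0 /\ j = j0 /\ k = k0) /\ (l < l0)%N.
pose b4 := (bcost b + rcost e + 6)%N.
suff run : runs (fill a b e) s (fun t => agree 1 s t /\ inv (W1 n) (rarr t))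
    (n * (n * (n * (n * (b4 + 12) + 12) + 12) + 12)).
  apply: (runs_leq (runs_sub run _)) => [t [st [fr wr]]|].
    by split=> //; [exact: (agree0 1%N)|move=> *; exact: wr].
  by rewrite /fill_cost -[54%N]/(6 + 48)%N addnA; exact: loop4_cost.
apply: (@runs_for _ _ _ _ (fun i0 => inv (W1 i0))) => //.
move=> i0 t1 i0n s1 x1 I1.
apply: (@runs_for _ _ _ _ (fun j0 => inv (W2 i0 j0))) => //.
- exact: (agree0 1%N).
(* An inner loop starts from the cells of the enclosing invariant and ends with one more slice of
   them; within the index bounds the descriptions coincide. *)
- by apply: inv_sub I1; rewrite /W2 /W1; lia.
- by move=> r; apply: inv_sub => i j k l lti ltj ltk ltl; rewrite /W2 /W1; lia.
move=> j0 t2 j0n s2 x2 I2.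
apply: (@runs_for _ _ _ _ (fun k0 => inv (W3 i0 j0 k0))) => //.
- by rewrite s2 // s1.
- by apply: inv_sub I2; rewrite /W3 /W2 /W1; lia.
- by move=> r; apply: inv_sub => i j k l lti ltj ltk ltl; rewrite /W3 /W2 /W1; lia.
move=> k0 t3 k0n s3 x3 I3.
apply: (@runs_for _ _ _ _ (fun l0 => inv (W4 i0 j0 k0 l0))) => //.
- by rewrite s3 // s2 // s1.
- by apply: inv_sub I3; rewrite /W4 /W3 /W2 /W1; lia.
- by move=> r; apply: inv_sub => i j k l lti ltj ltk ltl; rewrite /W4 /W3 /W2 /W1; lia.
move=> l0 t4 l0n s4 x4 [fr wr].
have t40 : ivar t4 0 = n by rewrite s4 // s3 // s2 // s1.
have t41 : ivar t4 1 = i0 by rewrite s4 // s3 // s2.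
have t42 : ivar t4 2 = j0 by rewrite s4 // s3.
have t43 : ivar t4 3 = k0 by rewrite s4.
have := step t4 t40 fr; rewrite t41 t42 t43 x4 => /(_ i0n j0n k0n l0n) val.
pose v := if beval t4 b then 0 else reval t4 e.
exists (set_rarr t4 a [:: i0; j0; k0; l0] v).
exists (bcost b + (4 + rcost (if beval t4 b then RNat 0 else e)).+1)%N; split.
(* Both branches are one assignment of a conditionally chosen expression. *)
- have -> : v = reval t4 (if beval t4 b then RNat 0 else e) by rewrite /v; case: ifP.
  apply: ExecIf.
  have := ExecRSet t4 a cell4 (if beval t4 b then RNat 0 else e).
  by rewrite /= t41 t42 t43 x4; case: ifP.
- by rewrite /b4; case: ifP => _ /=; lia.
split=> //; split=> [x xa|i j k l Wijkl lti ltj ltk ltl] /=; first by rewrite (negPf xa) fr.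
rewrite eqxx /=; case: eqP => [[-> -> -> ->] //|ne].
apply: wr => //; case: Wijkl => [|[[ei [ej ek]] l_lt]]; first by left.
right; split=> //; rewrite ltn_neqAle -ltnS l_lt andbT.
by apply/eqP => l_eq; apply: ne; rewrite ei ej ek l_eq.
Qed.

(** * Accumulating sums into a matrix *)

Definition sum_entries (a : nat) (e0 e : rexpr) : cmd :=
  for_loop 1 (for_loop 2 (Seq (RSet a [:: IVar 1; IVar 2] e0)
    (for_loop 3 (RSet a [:: IVar 1; IVar 2] (RAdd (RGet a [:: IVar 1; IVar 2]) e))))).

(** The loops take cubic time; the quartic form matches [fill_cost]. The constant 46 is 19 + 15 +
    12, the overheads at [n ^ 3], [n ^ 2] and [n]. *)
Definition sum_entries_cost (e0 e : rexpr) n : nat :=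
  n ^ 4 * (rcost e0 + rcost e + 46).

Lemma runs_sum_entries a e0 e s n (f : nat -> nat -> R) (g : nat -> nat -> nat -> R) :
    (0 < n)%N -> ivar s 0 = n ->
    (forall t, ivar t 0 = n -> (forall x, x != a -> rarr t x = rarr s x) ->
       (ivar t 1 < n)%N -> (ivar t 2 < n)%N ->
       reval t e0 = f (ivar t 1) (ivar t 2)) ->
    (forall t, ivar t 0 = n -> (forall x, x != a -> rarr t x = rarr s x) ->
       (ivar t 1 < n)%N -> (ivar t 2 < n)%N -> (ivar t 3 < n)%N ->
       reval t e = g (ivar t 1) (ivar t 2) (ivar t 3)) ->
  runs (sum_entries a e0 e) s
    (fun t => [/\ ivar t 0 = n, forall x, x != a -> rarr t x = rarr s x
       & forall i j, (i < n)%N -> (j < n)%N ->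
           rarr t a [:: i; j] = f i j + \sum_(k < n) g i j k])
    (sum_entries_cost e0 e n).
Proof.
move=> n0 sn fE gE.
pose out i j := f i j + \sum_(k < n) g i j k.
pose inv (W : nat -> nat -> Prop) r := (forall x, x != a -> r x = rarr s x) /\
  forall i j, W i j -> (i < n)%N -> (j < n)%N -> r a [:: i; j] = out i j.
have inv_sub (W W' : nat -> nat -> Prop) r :
    (forall i j, (i < n)%N -> (j < n)%N -> W' i j -> W i j) -> inv W r -> inv W' r.
  by move=> WW' [fr wr]; split=> // i j *; apply: wr => //; exact: WW'.
pose W1 i0 i (j : nat) := (i < i0)%N.
pose W2 i0 j0 i j := W1 i0 i j \/ i = i0 /\ (j < j0)%N.
pose b3 := (rcost e + 7)%N.
suff run : runs (sum_entries a e0 e) s (fun t => agree 1 s t /\ inv (W1 n) (rarr t))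
    (n * (n * (rcost e0 + 3 + n * (b3 + 12) + 12) + 12)).
  apply: (runs_leq (runs_sub run _)) => [t [st [fr wr]]|].
    by split=> // [|i j ilt jlt]; [rewrite st | exact: wr].
  have := leq_pexp2l n0 (isT : 1 <= 4)%N.
  have := leq_pexp2l n0 (isT : 2 <= 4)%N.
  have := leq_pexp2l n0 (isT : 3 <= 4)%N.
  rewrite /sum_entries_cost /b3 !expnS expn0; clear; nia.
apply: (@runs_for _ _ _ _ (fun i0 => inv (W1 i0))) => //.
move=> i0 t1 i0n s1 x1 I1.
apply: (@runs_for _ _ _ _ (fun j0 => inv (W2 i0 j0))) => //.
- by rewrite s1.
- by apply: inv_sub I1; rewrite /W2 /W1; lia.
- by move=> r; apply: inv_sub => i j lti ltj; rewrite /W2 /W1; lia.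
move=> j0 t2 j0n s2 x2 I2.
have [t20 t21] : ivar t2 0 = n /\ ivar t2 1 = i0 by rewrite !s2 // s1.
(* During the innermost loop the finished cells are kept and the current cell holds a partial
   sum. *)
pose inv3 k0 r := [/\ forall x, x != a -> r x = rarr s x,
  forall i j, W2 i0 j0 i j -> (i < n)%N -> (j < n)%N -> r a [:: i; j] = out i j
  & r a [:: i0; j0] = f i0 j0 + \sum_(k < k0) g i0 j0 k].
have cell_new i j : W2 i0 j0 i j -> ([:: i; j] == [:: i0; j0]) = false.
  by move=> Wij; apply/eqP => -[ei ej]; move: Wij; rewrite /W2 /W1 ei ej; lia.
apply: (@runs_seq _ _ _ (fun t => agree 3 t2 t /\ inv3 0%N (rarr t))).
  apply: (@runs_leq _ _ _ (2 + rcost e0).+1); last by lia.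
  case: I2 => fr wr; apply: runs_rset; split=> //=; rewrite t21 x2.
  split=> [x xa|i j Wij lti ltj|] /=; first by rewrite (negPf xa) fr.
    by rewrite eqxx cell_new ?wr.
  by rewrite !eqxx /= big_ord0 addr0 fE ?t21 ?x2.
move=> t3 [s3 I3].
apply: (@runs_sub _ _ (fun t => agree 3 t3 t /\ inv (W2 i0 j0.+1) (rarr t))); last first.
  by move=> t [s4 It]; split=> //; exact: agree_trans s4.
apply: (@runs_for _ _ _ _ inv3) => //.
- by rewrite s3.
- move=> r [fr wr cell]; split=> // i j Wij lti ltj.
  have [[-> ->]|ne] := eqVneq (i, j) (i0, j0); first exact: cell.
  apply: wr => //; move: ne Wij; rewrite xpair_eqE negb_and /W2 /W1; lia.
move=> k0 t4 k0n s4 x4 [fr wr cell].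
have [t40 [t41 t42]] : ivar t4 0 = n /\ ivar t4 1 = i0 /\ ivar t4 2 = j0.
  by rewrite !s4 // !s3.
apply: (@runs_leq _ _ _ (2 + (3 + rcost e).+1).+1); last by rewrite /b3; lia.
apply: runs_rset; split=> //=; rewrite t41 t42.
split=> [x xa|i j Wij lti ltj|] /=; first by rewrite (negPf xa) (fr x).
  by rewrite eqxx cell_new ?(wr i j).
by rewrite !eqxx /= big_ord_recr /= addrA cell gE ?t41 ?t42 ?x4.
Qed.

End Programs.

(** * The decomposition program *)

Definition or_test (b1 b2 : bexpr) : bexpr := BNot (BAnd (BNot b1) (BNot b2)).

Definition last_node : iexpr := ISub (IVar 0) (INat 1).

Definition is_last (x : nat) : bexpr := BEqI (IVar x) last_node.

(* Arrays: 0 holds Q, 1 and 2 receive the result, and 3, 4, 5 hold the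
   extension of Q by zero and its two successive reductions. *)
Definition decompose_program : cmd :=
  Seq (fill 3 (or_test (BEqI (IVar 1) (IVar 2)) (BEqI (IVar 3) (IVar 4))) (RGet 0 cell4))
  (Seq (fill 4 (or_test (is_last 3) (is_last 4))
    (RSub (RSub (RGet 3 cell4) (RGet 3 [:: IVar 1; IVar 2; IVar 3; last_node]))
          (RGet 3 [:: IVar 1; IVar 2; last_node; IVar 4])))
  (Seq (fill 5 (or_test (is_last 1) (is_last 2))
    (RSub (RSub (RGet 4 cell4) (RGet 4 [:: IVar 1; last_node; IVar 3; IVar 4]))
          (RGet 4 [:: last_node; IVar 2; IVar 3; IVar 4])))
  (Seq (fill 1 (BAnd (BEqI (IVar 1) (IVar 3)) (BEqI (IVar 2) (IVar 4)))
    (RDiv (RAdd (RGet 5 cell4) (RGet 5 [:: IVar 3; IVar 4; IVar 1; IVar 2])) (RNat 2)))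
  (sum_entries 2 (RGet 5 [:: IVar 1; IVar 2; IVar 1; IVar 2])
    (RAdd
      (RAdd (RGet 3 [:: IVar 1; IVar 2; IVar 3; last_node])
            (RGet 3 [:: IVar 1; IVar 2; last_node; IVar 3]))
      (RAdd (RGet 4 [:: IVar 3; last_node; IVar 1; IVar 2])
            (RGet 4 [:: last_node; IVar 3; IVar 1; IVar 2]))))))).

(** The input array is arbitrary at pairs that are not arcs, hence the two disequalities; the
    program writes zero there without reading. *)
Lemma holds_arcmx_ext (R : realType) n (s : store R) (Q : arcmx R n) (i j k l : nat) :
    holds_arcmx s 0 Q -> (i < n)%N -> (j < n)%N -> (k < n)%N -> (l < n)%N ->
    i != j -> k != l ->
  rarr s 0%N [:: i; j; k; l] = ext_arcmx Q i j k l.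
Proof.
move=> sQ lti ltj ltk ltl ij kl.
pose e : arcT n := Sub (Ordinal lti, Ordinal ltj) ij.
pose f : arcT n := Sub (Ordinal ltk, Ordinal ltl) kl.
by rewrite (sQ e f) -ext_arcmxE.
Qed.

Lemma decompose_program_correct (R : realType) n (Q : arcmx R n) : (0 < n)%N ->
  computes_at_cost decompose_program Q (quad_part Q)
    (\matrix_(i, j) linear_part Q i j) (500 * n ^ 4).
Proof.
move=> n0 s sn sQ; pose m := n.-1.
have lt_m : (m < n)%N by rewrite /m prednK.
pose q := ext_arcmx Q; pose q1 i j := right_reduced Q i j; pose q2 := reduced Q.
suff [s' [k [ex kb [h1 h2]]]] : runs decompose_program s
    (fun t => filled (rarr t) 1 n (sym_reduced Q) /\
      forall i j, (i < n)%N -> (j < n)%N -> rarr t 2%N [:: i; j] = linear_part Q i j)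
    (500 * n ^ 4).
  exists s', k; split=> // [e f|i j]; first by apply: h1; exact: ltn_ord.
  by rewrite mxE h2 ?ltn_ord.
(* The cost is left open, to be assembled from the five stages and compared at the end. *)
eapply runs_leq.
  apply: (@runs_seq _ _ _ _ (fun t => ivar t 0 = n /\ filled (rarr t) 3 n q)).
    apply: (runs_sub (runs_fill (out := q) n0 sn _)) => [t|t [? _ ?] //].
    move=> t0 fr t1 t2 t3 t4 /=; rewrite -negb_or negbK.
    case: ifPn => [diag|/norP[ij kl]]; first by rewrite /q ext_arcmx_diag.
    by rewrite fr // (holds_arcmx_ext sQ).
  move=> {sQ} {}s [{}sn s3].
  apply: (@runs_seq _ _ _ _ (fun t => [/\ ivar t 0 = n, filled (rarr t) 3 n q
    & filled (rarr t) 4 n q1])).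
    apply: (runs_sub (runs_fill (out := q1) n0 sn _)) => [t|t [? fr ?]]; last first.
      by split=> //; rewrite /filled fr.
    move=> t0 fr t1 t2 t3 t4 /=; rewrite -negb_or negbK.
    (* [subn1] turns [last_node] into [n.-1]; test and difference are then [right_reduced] by
       conversion. *)
    by rewrite t0 subn1 fr // !s3.
  move=> {s3} {}s [{}sn s3 s4].
  apply: (@runs_seq _ _ _ _ (fun t => [/\ ivar t 0 = n, filled (rarr t) 3 n q,
    filled (rarr t) 4 n q1 & filled (rarr t) 5 n q2])).
    apply: (runs_sub (runs_fill (out := q2) n0 sn _)) => [t|t [? fr ?]]; last first.
      by split=> //; rewrite /filled fr.
    move=> t0 fr t1 t2 t3 t4 /=; rewrite -negb_or negbK.
    by rewrite t0 subn1 fr // !s4.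
  move=> {s3 s4} {}s [{}sn s3 s4 s5].
  apply: (@runs_seq _ _ _ _ (fun t => [/\ ivar t 0 = n, filled (rarr t) 3 n q,
    filled (rarr t) 4 n q1, filled (rarr t) 5 n q2 & filled (rarr t) 1 n (sym_reduced Q)])).
    apply: (runs_sub (runs_fill (out := sym_reduced Q) n0 sn _)) => [t|t [? fr ?]]; last first.
      by split=> //; rewrite /filled fr.
    by move=> t0 fr t1 t2 t3 t4 /=; rewrite fr // !s5.
  move=> {s3 s4 s5} {}s [{}sn s3 s4 s5 s1].
  apply: (runs_sub (runs_sum_entries (f := fun i j => q2 i j i j)
    (g := fun i j k => (q i j k m + q i j m k) + (q1 k m i j + q1 m k i j)) n0 sn _ _)).
  - by move=> t t0 fr t1 t2 /=; rewrite fr // s5.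
  - by move=> t t0 fr t1 t2 t3 /=; rewrite t0 subn1 !fr // !s3 // !s4.
  - move=> t [_ fr acc]; split=> [|i j lti ltj]; first by rewrite /filled fr.
    by rewrite acc // big_split /= addrA.
(* The stages cost 69, 89, 89, 74 and 82 times [n ^ 4], in total 403, below the round figure 500. *)
rewrite /fill_cost /sum_entries_cost /=.
by rewrite -!mulnDr mulnC leq_mul2r orbT.
Qed.

Theorem theorem3 (R : realType) :
  exists (decomp : cmd) (K : nat),
    forall (n : nat) (Q : arcmx R n), (2 <= n)%N ->
    exists (QR : arcmx R n) (L : 'M[R]_n),
      [/\ quad_reduced QR,
          forall tau : {set arcT n}, tau \in tours n ->
            quad_value Q tau = quad_value QR tau + lin_value L tau
        & computes_at_cost decomp Q QR L (K * n ^ 4)].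
Proof.
exists decompose_program, 500 => n Q n2.
exists (quad_part Q), (\matrix_(i, j) linear_part Q i j); split.
- exact: quad_part_reduced.
- by move=> tau; exact: decompose_tour.
- by apply: decompose_program_correct; exact: ltnW.
Qed.
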